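(* Let $n>1$ be an integer and let $m$ be a positive rational number such that $mn$ is an integer. Then the following hold, where $F$ is the function defined in the context. (1) If $mn>4$, then $$[mn-3;\overline{ 1,mn^{k} -4}\,]_{k=2}^{\infty}=(mn-1)\, \frac{F(1/m,1,1/n)}{F(1/(mn),1,1/n)}.$$ (2) If $mn>2$, then $$[mn-2;\overline{ mn^{2k} +2, mn^{2k+1} -2}\,]_{k=1}^{\infty}=(mn-1)\, \frac{F(-1/m,1,-1/n)}{F(1/(mn),1,-1/n)}$$ and $$[mn+1;\overline{ 1, mn^{k} }\,]_{k=2}^{\infty}=(mn+1)\, \frac{F(-1/m,1,1/n)}{F(-1/(mn),1,1/n)}.$$ (3) If $mn^{2}>2$, then $$[mn+2;\overline{ mn^{2k} -2, mn^{2k+1} +2}\,]_{k=1}^{\infty}=(mn+1)\, \frac{F(1/m,1,-1/n)}{F(-1/(mn),1,-1/n)}.$$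
   Context: For complex $x,y,q$ with $|q|<1$, define $$F(x,y,q):=\sum_{j=0}^{\infty}\frac{(-1)^{j}x^{j}q^{j(j+1)/2}}{(q;q)_{j}\,(xq/y;q)_{j}},$$ where $(z;q)_0:=1$ and $(z;q)_j:=\prod_{i=0}^{j-1}(1-zq^{i})$ for $j\ge 1$. $[a_0;a_1,a_2,\ldots]$ denotes the (value of the) infinite regular continued fraction $a_0+\cfrac{1}{a_1+\cfrac{1}{a_2+\cdots}}$. The notation $[a_0;\overline{f_1(k),\ldots,f_r(k)}\,]_{k=k_0}^{\infty}$ means that after $a_0$ the partial quotients are the blocks $f_1(k),\ldots,f_r(k)$ for $k=k_0,k_0+1,k_0+2,\ldots$ concatenated in order. *)

(* Defs.v *)
From HB Require Import structures.
From mathcomp Require Import all_boot all_order all_algebra.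
From mathcomp Require Import complex.
From mathcomp Require Import all_classical all_reals all_analysis.
Import Order.TTheory GRing.Theory Num.Theory.
Import numFieldNormedType.Exports.

Set Implicit Arguments.
Unset Strict Implicit.
Unset Printing Implicit Defensive.

Local Open Scope classical_set_scope.
Local Open Scope ring_scope.

Definition qpoch (K : numFieldType) (z q : K) (j : nat) : K :=
  \prod_(i < j) (1 - z * q ^+ i).

Definition F_term (K : numFieldType) (x y q : K) (j : nat) : K :=
  (-1) ^+ j * x ^+ j * q ^+ (j * j.+1)./2
    / (qpoch q q j * qpoch (x * q / y) q j).

(* Meaningful for |q| < 1, y != 0 and nonvanishing denominators; [limn] and
   division are total. The complex function is the instance K := R[i]. *)
Definition F (K : numFieldType) (x y q : K) : K :=
  limn (series (F_term x y q)).

(* [a 0; a 1, ..., a N] *)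
Fixpoint cf_convergent (K : fieldType) (a : nat -> K) (N : nat) : K :=
  if N is N'.+1 then a 0%N + (cf_convergent (fun i => a i.+1) N')^-1
  else a 0%N.

(* [a 0; a 1, a 2, ...] is a regular continued fraction (integer partial
   quotients, positive from index 1 on), it converges, and its value is v. *)
Definition regular_cf_value (K : numFieldType) (a : nat -> rat) (v : K) : Prop :=
  [/\ forall i, a i \is a Num.int,
      forall i, (0 < i)%N -> 0 < a i &
      (fun N => ratr (cf_convergent a N) : K) @ \oo --> v].

(* The partial quotients a0, then the blocks f_1(k), ..., f_r(k) for
   k = k0, k0 + 1, ..., where fs = [:: f_1; ...; f_r] is nonempty. *)
Definition cf_blocks (a0 : rat) (fs : seq (nat -> rat)) (k0 i : nat) : rat :=
  if i is j.+1 then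
    nth (fun=> 0) fs (j %% size fs)%N (k0 + j %/ size fs)%N
  else a0.

(* Main.v *)
Require Import Defs.
From HB Require Import structures.
From mathcomp Require Import all_boot all_order all_algebra.
From mathcomp Require Import complex ring lra.
From mathcomp Require Import all_classical all_reals all_analysis.
Import Order.TTheory GRing.Theory Num.Theory.
Import numFieldNormedType.Exports.
Set Implicit Arguments.
Unset Strict Implicit.
Unset Printing Implicit Defensive.

Local Open Scope classical_set_scope.
Local Open Scope ring_scope.

(** Only F x 1 q enters, and for y = 1 it satisfies a three-term relation.
    Put c_k = x q^(k+1) and F_k = F (x q^k) 1 q.  Then
      (1 - c_k) F_k
        = (1 - 2 c_k) F_{k+1} - c_k c_{k+1} / (1 - c_{k+1}) F_{k+2}
    ([F_contiguous]): at the level of partial sums the difference of the two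
    sides telescopes to a boundary term that tends to 0.

    Multiplying F_k by the product of the |c_i| / (1 - c_i), i < k, turns this
    into
      s_k = (1/|c_k| - 2 sg c_k) s_{k+1} - sg q . s_{k+2}
    ([weighted_F_recurrence]), and s_0 / s_1 is the right-hand side of the
    theorem.  For x = +-1/m and q = +-1/n one has 1/|c_k| = m n^(k+1), so the
    coefficient of s_{k+1} is the integer m n^(k+1) -+ 2.  If q < 0 the
    recurrence reads s_k = a_k s_{k+1} + s_{k+2}, which is the recurrence behind
    the regular continued fraction [a_0; a_1, ...].  If q > 0 the minus sign
    gives the backward fraction b_0 - 1/(b_1 - 1/(b_2 - ...)); inserting the differences
    s_k - s_{k+1} between consecutive terms converts it to the regular
    fraction [b_0 - 1; 1, b_1 - 2, 1, b_2 - 2, ...].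

    A solution of u_i = a_i u_{i+1} + u_{i+2} with positive partial quotients
    need not represent the continued fraction: it does so when it is positive.
    Positivity propagates downwards from large indices, so it is enough that
    F_k tends to 1, which holds because c_k tends to 0 ([F_near1],
    [weighted_F_eventually]).  The same argument shows that the denominator
    F_1 does not vanish.

    Everything is done over the reals; the value is then moved to the complex
    numbers along the embedding of R in R[i].  The four formulas are two, one
    for each sign of q, with the sign of x q as a parameter e. *)

(** * The three-term relation for partial sums *)

Lemma F_term0 (K : numFieldType) (x q : K) : F_term x 1 q 0 = 1.
Proof. by rewrite /F_term /qpoch !big_ord0 !expr0 !mulr1 invr1 mulr1. Qed.

Lemma F_termS (K : numFieldType) (x q : K) (j : nat) :
  F_term x 1 q j.+1 =
  F_term x 1 q j * (- (x * q ^+ j.+1) / ((1 - q ^+ j.+1) * (1 - x * q ^+ j.+1))).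
Proof.
have tri : ((j.+1 * j.+2)./2 = (j * j.+1)./2 + j.+1)%N.
  by rewrite -addn2 mulnDr muln2 halfD doubleK odd_double andbF add0n mulnC.
rewrite /F_term /qpoch !big_ord_recr divr1 tri.
rewrite exprD -!mulrA -!exprS !invfM !exprS; ring.
Qed.

Lemma F_term_shift (K : numFieldType) (x q : K) (j : nat) :
  (forall i, 1 - x * q ^+ i.+1 != 0) ->
  F_term (x * q) 1 q j =
  F_term x 1 q j * (q ^+ j * (1 - x * q) / (1 - x * q ^+ j.+1)).
Proof.
move=> nz; elim: j => [|j IHj].
  rewrite expr0 expr1 mul1r mulfV; last by have := nz 0%N; rewrite expr1.
  by rewrite mulr1 !F_term0.
have n1 := nz j; have n2 := nz j.+1.
rewrite F_termS IHj [in RHS]F_termS; move: (F_term x 1 q j) => T.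
rewrite 2![(_ * (1 - _ * _))^-1]invfM.
move: n1 n2; rewrite !exprS; move: (q ^+ j) => Q n1 n2.
move: (1 - q * Q)^-1 => v.
by field; rewrite n2.
Qed.

(** Write t_j for the j-th term at x, Q = q^j and
    A_j = t_j / ((1 - x q Q) (1 - x q^2 Q)).  By [F_term_shift] the j-th term of
    the left-hand side is (1 - x q) times
    A_j (1 - Q) (1 - x q^2 Q) + A_j x q Q.  With B_j = t_j (1 - Q) / (1 - x q Q),
    the first summand is B_j and, by [F_termS], the second is - B_{j+1}, so the
    sum telescopes to - B_J. *)
Lemma series_F_term_contiguous (K : numFieldType) (x q : K) (J : nat) :
  (forall i, 1 - x * q ^+ i.+1 != 0) -> (forall i, 1 - q ^+ i.+1 != 0) ->
  (1 - x * q) * series (F_term x 1 q) J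
  - (1 - 2 * (x * q)) * series (F_term (x * q) 1 q) J
  + (x * q * (x * q ^+ 2)) / (1 - x * q ^+ 2)
    * series (F_term (x * q * q) 1 q) J
  = - ((1 - x * q) * (F_term x 1 q J * ((1 - q ^+ J) / (1 - x * q ^+ J.+1)))).
Proof.
move=> nx nq; rewrite /series /=; elim: J => [|J IHJ].
  by rewrite !big_nil expr0 subrr; ring.
rewrite !big_nat_recr //= !mulrDr opprD.
set S := (X in X = _).
(* S is the induction hypothesis plus the three terms of index J. *)
have -> : S =
  - ((1 - x * q) * (F_term x 1 q J * ((1 - q ^+ J) / (1 - x * q ^+ J.+1))))
  + ((1 - x * q) * F_term x 1 q J - (1 - 2 * (x * q)) * F_term (x * q) 1 q J
  + (x * q * (x * q ^+ 2)) / (1 - x * q ^+ 2) * F_term (x * q * q) 1 q J).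
  by rewrite -IHJ /S; ring.
have nx' i : 1 - x * q * q ^+ i.+1 != 0 by have := nx i.+1; rewrite exprS mulrA.
rewrite (@F_term_shift _ (x * q)) // F_term_shift // F_termS.
have n0 := nx 0%N; have n00 := nx 1%N.
have n1 := nx J; have n2 := nx J.+1; have n3 := nq J.
move: n0 n00 n1 n2 n3; rewrite expr1 !exprS expr0.
move: (q ^+ J) => Q n0 n00 n1 n2 n3.
by field; rewrite n1 n2 n3 -[q * q]mulr1 -mulrA n00.
Qed.

(** * Regular continued fractions from positive recurrences *)

Lemma int_ge1 (x : rat) : x \is a Num.int -> 0 < x -> 1 <= x.
Proof. by move=> /intrP[z ->]; rewrite ltr0z ler1z. Qed.

Lemma ratr_cf_convergent (K : numFieldType) (a : nat -> rat) (N : nat) :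
  ratr (cf_convergent a N) = cf_convergent (fun i => ratr (a i) : K) N.
Proof. by elim: N a => [//|N IHN] a /=; rewrite rmorphD fmorphV /= IHN. Qed.

Lemma cf_convergent_ge1 (K : realFieldType) (b : nat -> K) (N : nat) :
  (forall i, 1 <= b i) -> 1 <= cf_convergent b N.
Proof.
elim: N b => [|N IHN] b b1 /=; first exact: b1.
rewrite -[1]addr0 lerD // invr_ge0 (le_trans ler01) //.
by apply: IHN => i; apply: b1.
Qed.

(** The partial quotient b 0 is unconstrained.  Peeling it off multiplies the
    error by 1 / (C v), where C >= 1 is the remaining convergent and
    v = u 1 / u 2 is the value that it approximates; and 1 / v turns the bound
    u N.+3 / u 2 for the tail into u N.+3 / u 1. *)
Lemma cf_convergent_error (K : realFieldType) (b u : nat -> K) (N : nat) :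
  (forall i, 1 <= b i.+1) -> (forall i, 0 < u i.+1) ->
  (forall i, u i = b i * u i.+1 + u i.+2) ->
  `|cf_convergent b N - u 0%N / u 1%N| <= u N.+2 / u 1%N.
Proof.
elim: N b u => [|N IHN] b u b1 u0 rec /=.
  rewrite rec mulrDl mulfK ?gt_eqF // opprD addrA subrr sub0r normrN.
  by rewrite ger0_norm // divr_ge0 // ltW.
set C := cf_convergent _ _.
have C1 : 1 <= C by apply: cf_convergent_ge1 => i; apply: b1.
have C0 : 0 < C by apply: lt_le_trans C1.
have u1 := u0 0%N; have u2 := u0 1%N.
have := IHN (fun i => b i.+1) (fun i => u i.+1) (fun i => b1 i.+1)
  (fun i => u0 i.+1) (fun i => rec i.+1); rewrite -/C => err.
have -> : b 0%N + C^-1 - u 0%N / u 1%N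
        = - ((C - u 1%N / u 2%N) / C * (u 2%N / u 1%N)).
  by rewrite (rec 0%N); field; rewrite !gt_eqF.
have u21 : 0 <= u 2%N / u 1%N by rewrite divr_ge0 ?ltW.
rewrite normrN 2!normrM normfV (gtr0_norm C0) (ger0_norm u21).
have -> : u N.+3 / u 1%N = u N.+3 / u 2%N * (u 2%N / u 1%N).
  by rewrite mulrA divfK ?gt_eqF.
rewrite ler_wpM2r // ler_pdivrMr //; apply: le_trans err _.
by rewrite ler_peMr // divr_ge0 ?ltW.
Qed.

(** A positive solution decays at least like 1/N: since u decreases and
    u i.+2 <= u i - u i.+1, the values u 3, ..., u N.+2 sum to at most
    u 1 - u N.+1.  This crude rate suffices for convergence. *)
Lemma recurrence_decay (K : realFieldType) (b u : nat -> K) (N : nat) :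
  (forall i, 1 <= b i.+1) -> (forall i, 0 < u i.+1) ->
  (forall i, u i = b i * u i.+1 + u i.+2) ->
  N%:R * u N.+2 + u N.+1 <= u 1%N.
Proof.
move=> b1 u0 rec; elim: N => [|N IHN]; first by rewrite mul0r add0r.
apply: le_trans IHN; rewrite [u N.+1]rec.
have bu i : u i.+2 <= b i.+1 * u i.+2 by rewrite ler_peMl // ltW.
have bu0 := bu N; have bu1 := bu N.+1; have u4 := u0 N.+3.
have d : N%:R * u N.+3 <= N%:R * u N.+2.
  by rewrite ler_wpM2l // [u N.+2]rec; lra.
rewrite -natr1 mulrDl mul1r; lra.
Qed.

(** Positivity is only asked for large indices, which is where asymptotics are
    known: the coefficients being positive, it propagates down to index 1. *)
Lemma regular_cf_value_of_recurrence (R : realType)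
    (a : nat -> rat) (u : nat -> R) :
  (forall i, a i \is a Num.int) -> (forall i, (0 < i)%N -> 0 < a i) ->
  (forall i, u i = ratr (a i) * u i.+1 + u i.+2) ->
  (exists K, forall i, (K <= i)%N -> 0 < u i) ->
  regular_cf_value a (u 0%N / u 1%N).
Proof.
move=> a_int a_pos rec [K Kpos]; split=> //.
pose b i : R := ratr (a i).
have b1 i : 1 <= b i.+1.
  by rewrite /b -(rmorph1 (@ratr R)) ler_rat int_ge1 ?a_pos.
have u_pos i : 0 < u i.+1.
  suff : forall k j, (K <= j.+1 + k)%N -> 0 < u j.+1.
    by apply; exact: leq_addl.
  elim=> [|k IHk] j; first by rewrite addn0; exact: Kpos.
  rewrite addnS -addSn => hk; rewrite rec addr_gt0 //; last first.
    by apply: IHk; apply: leq_trans hk _; rewrite leq_add2r.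
  by rewrite mulr_gt0 ?IHk // (lt_le_trans ltr01) // b1.
have -> : (fun N => ratr (cf_convergent a N) : R) = cf_convergent b.
  by apply/funext => N; rewrite ratr_cf_convergent.
have bound N : `|cf_convergent b N - u 0%N / u 1%N| <= @harmonic R N.
  apply: le_trans (cf_convergent_error N b1 u_pos rec) _.
  have dec := recurrence_decay N b1 u_pos rec.
  rewrite /harmonic /= ler_pdivrMr // ler_pdivlMl //.
  have bu : u N.+2 <= b N.+1 * u N.+2 by rewrite ler_peMl // ltW.
  have u3 := u_pos N.+2; have recN : u N.+1 = b N.+1 * u N.+2 + u N.+3 := rec _.
  by rewrite -natr1; lra.
apply/cvgrPdist_le => e e0.
have /cvgrPdist_le/(_ e e0) := @cvg_harmonic R; apply: filterS => N.
rewrite sub0r normrN distrC ger0_norm; last by rewrite /harmonic /= invr_ge0.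
exact/le_trans/bound.
Qed.

Lemma nat_parity_ind (P : nat -> Prop) : P 0%N -> (forall i, P i.*2.+1) ->
  (forall i, P i.*2.+2) -> forall i, P i.
Proof.
move=> P0 P1 P2 [//|i]; rewrite -(odd_double_half i).
by case: (odd i); [exact: P2 | exact: P1].
Qed.

(** The sequence s 0, s 1, s 1 - s 2, s 2, s 2 - s 3, s 3, ... satisfies a
    recurrence with plus signs: s k = 1 * (s k - s k.+1) + s k.+1, and
    s k - s k.+1 = (b k - 2) * s k.+1 + (s k.+1 - s k.+2).  It starts with
    s 0 in place of s 0 - s 1, whence b 0 - 1 instead of b 0 - 2. *)
Lemma regular_cf_value_of_backward_recurrence (R : realType)
    (a b : nat -> rat) (s : nat -> R) :
  (forall k, b k \is a Num.int) -> (forall k, 2 < b k.+1) ->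
  a 0%N = b 0%N - 1 -> (forall i, a i.*2.+1 = 1) ->
  (forall i, a i.*2.+2 = b i.+1 - 2) ->
  (forall k, s k = ratr (b k) * s k.+1 - s k.+2) ->
  (exists K, forall k, (K <= k)%N -> 0 < s k.+1 < s k) ->
  regular_cf_value a (s 0%N / s 1%N).
Proof.
move=> b_int b_gt2 a0 a_odd a_even rec [K Kpos].
pose u i : R :=
  if i is j.+1 then s j./2.+1 - (odd j)%:R * s j./2.+2 else s 0%N.
have u_odd i : u i.*2.+1 = s i.+1.
  by rewrite /u odd_double doubleK mul0r subr0.
have u_even i : u i.*2.+2 = s i.+1 - s i.+2.
  by rewrite /u /= odd_double uphalf_double mul1r.
have -> : s 0%N / s 1%N = u 0%N / u 1%N by rewrite (u_odd 0%N).
apply: regular_cf_value_of_recurrence.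
- by apply: nat_parity_ind => [|i|i]; rewrite ?a0 ?a_odd ?a_even ?rpredB.
- by apply: nat_parity_ind => [//|i|i] _; rewrite ?a_odd ?a_even ?subr_gt0.
- apply: nat_parity_ind => [|i|i].
  + rewrite a0 (u_odd 0%N) (u_even 0%N) /= (rec 0%N) rmorphB rmorph1; ring.
  + rewrite a_odd u_odd u_even -doubleS u_odd rmorph1; ring.
  + rewrite a_even u_even -doubleS u_odd u_even (rec i.+1).
    by rewrite rmorphB rmorph_nat; ring.
- exists K.*2.+1; apply: nat_parity_ind => [//|i|i]; rewrite ?u_odd ?u_even.
  + by rewrite ltnS leq_double => /Kpos/andP[].
  + move=> le; have /Kpos/andP[_] : (K <= i.+1)%N.
      by rewrite -leq_double doubleS; apply: leq_trans le; rewrite leqnSn.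
    by rewrite subr_gt0.
Qed.

(** * Analytic estimates *)

(** A parameter range that contains the four cases, is stable under
    x |-> x q, and keeps the factors 1 - q^i and 1 - x q^i (i > 0) of the
    denominators at least 1/2.  The last bound is one-sided because
    x q = -1 is allowed: it occurs for m n = 1. *)
Definition tame (R : realType) (x q : R) : Prop :=
  [/\ `|q| <= 2^-1, `|x * q| <= 1 & forall i, x * q ^+ i.+1 <= 2^-1].

Section Tame.
Context (R : realType).
Implicit Types x q : R.

Lemma tame_pow_le x q j : tame x q -> `|x * q ^+ j.+1| <= `|x * q| / 2 ^+ j.
Proof.
case=> q2 _ _; rewrite exprS mulrA normrM normrX -exprVn ler_wpM2l //.
by rewrite lerXn2r ?nnegrE.
Qed.

Lemma tame_shift x q : tame x q -> tame (x * q) q.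
Proof.
move=> tq; have [q2 xq1 xq2] := tq; split=> //; last first.
  by move=> i; rewrite -mulrA -exprS.
have := tame_pow_le 1 tq; rewrite expr2 mulrA expr1 => /le_trans; apply; lra.
Qed.

Lemma tame_iter x q k : tame x q -> tame (x * q ^+ k) q.
Proof.
move=> tq; elim: k => [|k IHk]; first by rewrite expr0 mulr1.
by rewrite exprSr mulrA; apply: tame_shift.
Qed.

Lemma tame_den x q i : tame x q -> 2^-1 <= 1 - x * q ^+ i.+1.
Proof. by case=> _ _ /(_ i) h; lra. Qed.

Lemma tame_qden x q i : tame x q -> 2^-1 <= 1 - q ^+ i.+1.
Proof.
case=> q2 _ _; have : `|q ^+ i.+1| <= 2^-1.
  rewrite normrX exprS; apply: le_trans (q2).
  by rewrite ler_piMr // exprn_ile1 //; lra.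
by rewrite ler_norml => /andP[_ h]; lra.
Qed.

Lemma tame_den_neq0 x q i : tame x q -> 1 - x * q ^+ i.+1 != 0.
Proof. by move=> /(tame_den i) h; rewrite gt_eqF //; lra. Qed.

Lemma tame_qden_neq0 x q i : tame x q -> 1 - q ^+ i.+1 != 0.
Proof. by move=> /(tame_qden i) h; rewrite gt_eqF //; lra. Qed.

Lemma F_term_ratio x q j : tame x q ->
  `|F_term x 1 q j.+1| <= 4 * (`|x * q| / 2 ^+ j) * `|F_term x 1 q j|.
Proof.
move=> tq; rewrite F_termS normrM mulrC ler_wpM2r // normrM normrN normfV.
have d1 := tame_den j tq; have d2 := tame_qden j tq.
have d : 4^-1 <= (1 - q ^+ j.+1) * (1 - x * q ^+ j.+1) by nra.
have d0 : 0 <= (1 - q ^+ j.+1) * (1 - x * q ^+ j.+1) by lra.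
rewrite (ger0_norm d0) mulrC ler_pM ?invr_ge0 //.
  by rewrite -[leRHS]invrK lef_pV2 ?posrE //; lra.
exact: tame_pow_le.
Qed.

(** By [F_term_ratio] the j-th ratio is at most 4 / 2^j, so the terms may grow
    at first (to 8 |x q|) and shrink by 1/2 or more from index 3 on; the
    constant 32 absorbs the first terms. *)
Lemma F_term_bound x q j : tame x q ->
  `|F_term x 1 q j.+1| <= 32 * `|x * q| / 2 ^+ j.
Proof.
move=> tq; have [_ xq1 _] := tq; set c := `|x * q| in xq1 *.
have c0 : 0 <= c := normr_ge0 _.
have r j := F_term_ratio j tq; rewrite -/c in r.
have t0 : `|F_term x 1 q 0| = 1.
  by rewrite F_term0 normr1.
have t1 : `|F_term x 1 q 1| <= 4 * c.
  by have := r 0%N; rewrite t0 expr0 divr1 mulr1.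
have t2 : `|F_term x 1 q 2| <= 8 * c.
  have := r 1%N; rewrite expr1; have := normr_ge0 (F_term x 1 q 1); nra.
elim: j => [|j IHj]; first by rewrite expr0; lra.
case: j IHj => [|j] IHj; first by rewrite expr1; lra.
apply: le_trans (r j.+2) _.
(* For the term of index 3 the induction hypothesis is weaker than t2. *)
case: j IHj => [|j] IHj.
  by have := normr_ge0 (F_term x 1 q 2); rewrite !exprS expr0; nra.
have p : 0 < (2 : R) ^+ j by rewrite exprn_gt0.
have p1 : 1 <= (2 : R) ^+ j by rewrite exprn_ege1 // ler1n.
have pV : ((2 : R) ^+ j)^-1 <= 1 by rewrite invf_le1.
have pV0 : 0 <= ((2 : R) ^+ j)^-1 by rewrite invr_ge0 ltW.
have cv : c * ((2 : R) ^+ j)^-1 <= 1 by nra.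
move: IHj cv; rewrite !exprS !invfM.
move: `|_| (normr_ge0 (F_term x 1 q j.+3)) => t t_ge0.
move: (_ ^+ j)^-1 pV pV0 => v v1 v0 IH cv.
have : (c * v) * t <= t by rewrite ler_piMl.
lra.
Qed.

Lemma is_cvg_series_F_term x q : tame x q -> cvgn (series (F_term x 1 q)).
Proof.
move=> tq; apply: normed_cvg.
have [_ xq1 _] := tq.
apply: (@series_le_cvg _ _ (geometric 64 2^-1)) => [j|j|j|].
- exact: normr_ge0.
- by rewrite /geometric /= mulr_ge0 // exprn_ge0.
- rewrite /geometric /=; case: j => [|j].
    rewrite F_term0 normr1; lra.
  apply: le_trans (F_term_bound j tq) _; rewrite exprVn exprS invfM.
  have : 0 <= ((2 : R) ^+ j)^-1 by rewrite invr_ge0 exprn_ge0.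
  move: (_^-1) => v; have := normr_ge0 (x * q); nra.
- by apply: is_cvg_geometric_series; rewrite ger0_norm //; lra.
Qed.

Lemma F_near1 x q : tame x q -> `|F x 1 q - 1| <= 64 * `|x * q|.
Proof.
move=> tq; set c := `|x * q|; have c0 : 0 <= c := normr_ge0 _.
have S_bound J : `|series (F_term x 1 q) J.+1 - 1| <= 64 * c - 64 * c / 2 ^+ J.
  rewrite /series /=; elim: J => [|J IHJ].
    by rewrite big_nat1 F_term0 subrr normr0; lra.
  rewrite big_nat_recr //= addrAC; apply: le_trans (ler_normD _ _) _.
  have := F_term_bound J tq; rewrite -/c exprS invfM; lra.
have near_bound : \forall J \near \oo,
    1 - 64 * c <= series (F_term x 1 q) J <= 1 + 64 * c.
  exists 1%N => // -[//|J] _ /=.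
  rewrite -ler_distl; apply: le_trans (S_bound J) _.
  by rewrite gerBl // mulr_ge0 ?invr_ge0 ?exprn_ge0 // mulr_ge0.
have cv := is_cvg_series_F_term tq.
rewrite ler_distl /F; apply/andP; split.
  by apply: limr_ge => //; apply: filterS near_bound => J /andP[].
by apply: limr_le => //; apply: filterS near_bound => J /andP[].
Qed.

(** Passing to the limit in [series_F_term_contiguous]: the boundary term has
    the factor F_term x 1 q J, which tends to 0. *)
Lemma F_contiguous x q : tame x q ->
  (1 - x * q) * F x 1 q = (1 - 2 * (x * q)) * F (x * q) 1 q
  - (x * q * (x * q ^+ 2)) / (1 - x * q ^+ 2) * F (x * q * q) 1 q.
Proof.
move=> tq; have t1 := tame_shift tq; have t2 := tame_shift t1.
have [q2 _ _] := tq.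
have q1 : `|q| < 1 by lra.
have lhs : (fun J => (1 - x * q) * series (F_term x 1 q) J
  - (1 - 2 * (x * q)) * series (F_term (x * q) 1 q) J
  + (x * q * (x * q ^+ 2)) / (1 - x * q ^+ 2)
    * series (F_term (x * q * q) 1 q) J) @ \oo -->
  ((1 - x * q) * F x 1 q - (1 - 2 * (x * q)) * F (x * q) 1 q
  + (x * q * (x * q ^+ 2)) / (1 - x * q ^+ 2) * F (x * q * q) 1 q).
  by apply: cvgD; [apply: cvgB|]; apply: cvgM (@cvg_cst _ _ _ _ _) _;
    apply: is_cvg_series_F_term.
have rhs : (fun J => - ((1 - x * q) *
    (F_term x 1 q J * ((1 - q ^+ J) / (1 - x * q ^+ J.+1)))))
    @ \oo --> - ((1 - x * q) * (0 * ((1 - 0) / (1 - x * q * 0)))).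
  have qJ := cvg_expr q1.
  apply: cvgN; apply: cvgM (@cvg_cst _ _ _ _ _) _.
  apply: cvgM; first exact: cvg_series_cvg_0 (is_cvg_series_F_term tq).
  apply: cvgM; first by apply: cvgB => //; apply: cvg_cst.
  apply: cvgV; first by rewrite mulr0 subr0 oner_eq0.
  under eq_fun do rewrite exprS mulrA.
  by apply: cvgB (@cvg_cst _ _ _ _ _) _; apply: cvgM (@cvg_cst _ _ _ _ _) _.
have nx i := tame_den_neq0 i tq; have nq i := tame_qden_neq0 i tq.
move: lhs; under eq_fun do rewrite series_F_term_contiguous //.
move=> /cvg_unique => /(_ (@norm_hausdorff _ _) _ rhs).
rewrite mul0r mulr0 oppr0; lra.
Qed.

End Tame.

(** * The quotient of two values of F as a continued fraction *)

Section Value.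
Context (R : realType) (x q : R).
Hypotheses (tq : tame x q) (x0 : x != 0) (q0 : q != 0).

Local Notation c k := (x * q ^+ k.+1).
Local Notation G k := (F (x * q ^+ k) 1 q).

(** The weights are the ones for which the coefficient of the term of index
    k.+2 in the recurrence is a sign; the absolute values keep them positive. *)
Definition weighted_F k : R := G k * \prod_(i < k) (`|c i| / (1 - c i)).
Local Notation s := weighted_F.

Lemma weighted_F_recurrence k :
  s k = (`|c k|^-1 - 2 * Num.sg (c k)) * s k.+1 - Num.sg q * s k.+2.
Proof.
rewrite /weighted_F !big_ord_recr /=; set E := \prod_(i < k) _.
have ck0 : c k != 0 by rewrite mulf_neq0 // expf_neq0.
have d1 := tame_den_neq0 k tq; have d2 := tame_den_neq0 k.+1 tq.
have cS j : x * q ^+ j * q = c j by rewrite -mulrA -exprSr.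
have G_k : G k = ((1 - 2 * c k) * G k.+1
    - c k * c k.+1 / (1 - c k.+1) * G k.+2) / (1 - c k).
  apply: (mulIf d1); rewrite divfK // mulrC.
  have := F_contiguous (tame_iter k tq).
  have -> : x * q ^+ k * q ^+ 2 = c k.+1 by rewrite -!cS expr2 mulrA.
  by rewrite !cS.
rewrite {}G_k.
move: (G k.+1) (G k.+2) => G1 G2.
have cq : c k.+1 = c k * q by rewrite exprSr mulrA.
rewrite cq in d2 *; move: (c k) ck0 d1 d2 => z z0 d1 d2.
have sg1 (t : R) : t != 0 -> Num.sg t = 1 \/ Num.sg t = -1.
  by move=> t0; case: (sgrP t) t0 => [||] //; rewrite ?eqxx; [left|right].
rewrite normrM (normrEsg q) (normrEsg z).
have [->|->] := sg1 z z0; have [->|->] := sg1 q q0;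
  by field; rewrite ?z0 ?q0 ?d1 ?d2.
Qed.

(** From index 8 on |c k| <= 2^-8, so F is within 64 * 2^-8 = 1/4 of 1, while
    the ratio of consecutive weights is below 1/2; and 5/4 * 1/2 < 3/4. *)
Lemma weighted_F_eventually k : (8 <= k)%N -> 0 < s k.+1 < s k.
Proof.
move=> k8.
have small j : (8 <= j)%N -> `|c j| <= 256^-1.
  move=> j8; have [_ xq1 _] := tq; apply: le_trans (tame_pow_le j tq) _.
  have h : ((2 : R) ^+ j)^-1 <= 256^-1.
    rewrite lef_pV2 ?posrE ?exprn_gt0 // (_ : 256 = 2 ^+ 8); last by ring.
    by rewrite ler_eXn2l ?ltr1n.
  by apply: le_trans h; rewrite ler_piMl // invr_ge0 exprn_ge0.
have G_near j : (8 <= j)%N -> 3/4 <= G j <= 5/4.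
  move=> j8; have := F_near1 (tame_iter j tq).
  rewrite -mulrA -exprSr ler_norml => /andP[]; have := small j j8; lra.
have /andP[G1 _] := G_near k k8.
have /andP[G3 G4] := G_near k.+1 (leqW k8).
have d := tame_den k tq; have ck := small k k8.
have E_gt0 j : 0 < \prod_(i < j) (`|c i| / (1 - c i)).
  apply: prodr_gt0 => i _; have := tame_den i tq => di.
  by rewrite divr_gt0 ?normr_gt0 ?mulf_neq0 ?expf_neq0 //; lra.
apply/andP; split; first by rewrite mulr_gt0 //; lra.
rewrite /weighted_F big_ord_recr /= mulrCA [ltRHS]mulrC (ltr_pM2l (E_gt0 k)).
have r : `|c k| / (1 - c k) <= 2^-1.
  by rewrite ler_pdivrMr; lra.
have r0 : 0 <= `|c k| / (1 - c k) by rewrite divr_ge0 //; lra.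
nra.
Qed.

Lemma weighted_F_quotient :
  s 0 / s 1 = (1 - x * q) / `|x * q| * (F x 1 q / F (x * q) 1 q).
Proof.
rewrite /weighted_F big_ord0 big_ord1 expr0 expr1 !mulr1.
by rewrite invfM invf_div mulrA mulrC.
Qed.

Lemma regular_cf_value_neg_base (a : nat -> rat) :
  q < 0 -> (forall k, a k \is a Num.int) -> (forall k, 0 < a k.+1) ->
  (forall k, ratr (a k) = `|c k|^-1 - 2 * Num.sg (c k)) ->
  regular_cf_value a ((1 - x * q) / `|x * q| * (F x 1 q / F (x * q) 1 q)).
Proof.
move=> q_lt0 a_int a_pos a_def; rewrite -weighted_F_quotient.
apply: regular_cf_value_of_recurrence => //; first by case.
  by move=> k; rewrite weighted_F_recurrence a_def (ltr0_sg q_lt0) mulN1r opprK.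
by exists 9 => -[//|k] /weighted_F_eventually /andP[].
Qed.

Lemma regular_cf_value_pos_base (a b : nat -> rat) :
  0 < q -> (forall k, b k \is a Num.int) -> (forall k, 2 < b k.+1) ->
  (forall k, ratr (b k) = `|c k|^-1 - 2 * Num.sg (c k)) ->
  a 0%N = b 0%N - 1 -> (forall i, a i.*2.+1 = 1) ->
  (forall i, a i.*2.+2 = b i.+1 - 2) ->
  regular_cf_value a ((1 - x * q) / `|x * q| * (F x 1 q / F (x * q) 1 q)).
Proof.
move=> q_gt0 b_int b_gt2 b_def a0 a1 a2; rewrite -weighted_F_quotient.
apply: (regular_cf_value_of_backward_recurrence b_int) => //.
  by move=> k; rewrite weighted_F_recurrence b_def (gtr0_sg q_gt0) mul1r.
by exists 8; exact: weighted_F_eventually.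
Qed.

End Value.

(** * From the real to the complex numbers *)

Section RealComplex.
Context (R : realType).
Local Notation "z %:C" := (real_complex R z).
Local Notation C := (R[i] : numFieldType).

(** The target is ascribed the type C so that the limit is taken for the
    topology that a numFieldType carries by its norm. *)
Lemma cvg_real_complex (f : nat -> R) (l : R) :
  f @ \oo --> l -> (fun n => (f n)%:C : C) @ \oo --> (l%:C : C).
Proof.
move=> fl; apply/cvgrPdist_le => e e0.
have eE : e = (complex.Re e)%:C by rewrite RRe_real // gtr0_real.
have e'0 : 0 < complex.Re e by move: e0; rewrite {1}eE ltcR.
move/cvgrPdist_le: fl => /(_ _ e'0); apply: filterS => n.
by rewrite eE -rmorphB normc_def /= expr0n addr0 sqrtr_sqr lecR.
Qed.

Lemma F_term_real_complex (x q : R) j :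
  F_term x%:C 1 q%:C j = (F_term x 1 q j)%:C.
Proof.
rewrite /F_term /qpoch fmorph_div !rmorphM !rmorphXn rmorphN1 !rmorph_prod.
congr (_ / (_ * _)); apply: eq_bigr => i _.
  by rewrite rmorphB rmorph1 rmorphM rmorphXn.
by rewrite !divr1 rmorphB rmorph1 !rmorphM rmorphXn.
Qed.

Lemma F_real_complex (x q : R) : tame x q -> F x%:C 1 q%:C = (F x 1 q)%:C.
Proof.
move=> tq; apply: cvg_lim; first exact: norm_hausdorff.
have -> : series (F_term x%:C 1 q%:C) = fun n => (series (F_term x 1 q) n)%:C.
  apply/funext => n; rewrite /series /= rmorph_sum.
  by apply: eq_bigr => j _; rewrite F_term_real_complex.
exact/cvg_real_complex/is_cvg_series_F_term.
Qed.

Lemma regular_cf_value_real_complex (a : nat -> rat) (x q w : R) : tame x q ->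
  regular_cf_value a (w * (F x 1 q / F (x * q) 1 q)) ->
  regular_cf_value a (w%:C * (F x%:C 1 q%:C / F (x%:C * q%:C) 1 q%:C)).
Proof.
move=> tq [a_int a_pos a_cvg]; split=> //.
rewrite -rmorphM !F_real_complex //; last exact: tame_shift.
rewrite -fmorph_div -rmorphM.
have -> : (fun N => ratr (cf_convergent a N) : R[i])
        = fun N => (ratr (cf_convergent a N))%:C.
  by apply/funext => N; rewrite fmorph_rat.
exact: cvg_real_complex.
Qed.

End RealComplex.

(** * The parameters of the theorem *)

Lemma cf_blocks_odd a0 f g k0 i :
  cf_blocks a0 [:: f; g] k0 i.*2.+1 = f (k0 + i)%N.
Proof. by rewrite /cf_blocks /= modn2 odd_double divn2 doubleK. Qed.

Lemma cf_blocks_even a0 f g k0 i :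
  cf_blocks a0 [:: f; g] k0 i.*2.+2 = g (k0 + i)%N.
Proof. by rewrite /cf_blocks /= modn2 /= odd_double divn2 /= uphalf_double. Qed.

Section Bases.
Context (R : realType) (n : nat) (m : rat).
Hypotheses (hn : (1 < n)%N) (hm : 0 < m) (hmn : m * n%:R \is a Num.int).

Lemma mn_pow_int k : m * n%:R ^+ k.+1 \is a Num.int.
Proof. by rewrite exprS mulrA rpredM // rpredX // natr_int. Qed.

Lemma double_sign_int j : 2 * (-1) ^+ j \is a @Num.int rat.
Proof. by rewrite rpredM ?natr_int // rpredX // rpredN. Qed.

Lemma ratr_double_sign j : ratr (2 * (-1) ^+ j) = 2 * (-1) ^+ j :> R.
Proof. by rewrite rmorphM rmorphXn rmorphN1 rmorph_nat. Qed.

Lemma mn_pow_le j k : (j <= k)%N -> m * n%:R ^+ j <= m * n%:R ^+ k.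
Proof.
by move=> jk; rewrite (ler_wpM2l (ltW hm)) // ler_weXn2l // ler1n ltnW.
Qed.

Local Notation "z %:C" := (real_complex _ z).
Local Notation P k := (ratr (m * n%:R ^+ k) : R).

Lemma mn_pow_gt0 k : 0 < P k.
Proof. by rewrite ltr0q mulr_gt0 // exprn_gt0 // ltr0n ltnW. Qed.

Lemma tame_of_norms (x q : R) : `|q| = n%:R^-1 -> `|x * q| = (P 1)^-1 ->
  (forall i, x * q ^+ i.+1 <= 2^-1) -> tame x q.
Proof.
move=> q_n xq_n c_le; split=> //.
  by rewrite q_n lef_pV2 ?posrE ?ltr0n // ?ler_nat // ltnW.
rewrite xq_n invf_le1 ?mn_pow_gt0 // -(rmorph1 (@ratr R)) ler_rat.
by rewrite int_ge1 ?mn_pow_int // -(ltr0q R) mn_pow_gt0.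
Qed.

Lemma signed_partial_quotient (c p : R) (j : nat) : 0 < p ->
  c = (-1) ^+ j / p -> `|c|^-1 - 2 * Num.sg c = p - 2 * (-1) ^+ j.
Proof.
move=> p0 ->; have pV : 0 < p^-1 by rewrite invr_gt0.
rewrite -signr_odd normrMsign (gtr0_norm pV) invrK sgrM (gtr0_sg pV) mulr1.
by case: (odd j); rewrite ?expr1 ?expr0 ?sgrN1 ?sgr1.
Qed.

Lemma signed_prefactor (c p : R) (j : nat) : 0 < p ->
  c = (-1) ^+ j / p -> (1 - c) / `|c| = p - (-1) ^+ j.
Proof.
move=> p0 ->; have pV : 0 < p^-1 by rewrite invr_gt0.
rewrite -signr_odd normrMsign (gtr0_norm pV) invrK mulrBl mul1r.
by rewrite divfK // gt_eqF.
Qed.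

Lemma half_ge_signed (p : R) (j : nat) : 0 < p -> 2 * (-1) ^+ j <= p ->
  (-1) ^+ j / p <= 2^-1.
Proof. by move=> p0; rewrite ler_pdivrMr //; lra. Qed.

(** Here x q^k = (-1)^e / (m n^k) for all k > 0, so the backward recurrence has
    the coefficients b k = m n^(k+1) - 2 (-1)^e.  The hypothesis on m n covers
    both b k.+1 > 2 and the bound x q^k <= 1/2, which for e = 1 are automatic. *)
Lemma F_quotient_pos_base (e : bool) (a : nat -> rat) :
  2 + 2 * (-1) ^+ e < m * n%:R ->
  a 0%N = m * n%:R - 2 * (-1) ^+ e - 1 -> (forall i, a i.*2.+1 = 1) ->
  (forall i, a i.*2.+2 = m * n%:R ^+ i.+2 - 2 * (-1) ^+ e - 2) ->
  let M : R[i] := ratr m in let N : R[i] := n%:R in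
  regular_cf_value a ((M * N - (-1) ^+ e) *
    (F ((-1) ^+ e / M) 1 (1 / N) / F ((-1) ^+ e / (M * N)) 1 (1 / N))).
Proof.
move=> mn_gt a0 a1 a2 M N.
pose x : R := (-1) ^+ e / ratr m; pose q : R := n%:R^-1.
have n0 : (0 : R) < n%:R by rewrite ltr0n ltnW.
have m0 : (0 : R) < ratr m by rewrite ltr0q.
have cE k : x * q ^+ k.+1 = (-1) ^+ e / P k.+1.
  rewrite /x /q exprVn rmorphM rmorphXn /= ratr_nat.
  by rewrite [(ratr m * _)^-1]invfM mulrA.
have tq : tame x q.
  apply: tame_of_norms; first by rewrite /q gtr0_norm // invr_gt0.
    have := cE 0%N; rewrite expr1 => ->.
    by rewrite normrMsign gtr0_norm // invr_gt0 mn_pow_gt0.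
  move=> i; rewrite cE half_ge_signed ?mn_pow_gt0 //.
  rewrite -ratr_double_sign ler_rat.
  by have := mn_pow_le (isT : (1 <= i.+1)%N); rewrite expr1; lra.
have x0 : x != 0 by rewrite mulf_neq0 ?signr_eq0 // invr_eq0 gt_eqF.
have q_gt0 : 0 < q by rewrite invr_gt0.
have q_neq0 := lt0r_neq0 q_gt0.
pose b k : rat := m * n%:R ^+ k.+1 - 2 * (-1) ^+ e.
have cfa : regular_cf_value a
    ((1 - x * q) / `|x * q| * (F x 1 q / F (x * q) 1 q)).
  apply: (@regular_cf_value_pos_base R x q tq x0 q_neq0 a b) => //.
  - by move=> k; rewrite rpredB ?mn_pow_int ?double_sign_int.
  - by move=> k; have := mn_pow_le (isT : (1 <= k.+2)%N); rewrite /b expr1; lra.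
  - move=> k; rewrite (signed_partial_quotient _ (cE k)) ?mn_pow_gt0 //.
    by rewrite rmorphB /= ratr_double_sign.
have := regular_cf_value_real_complex tq cfa.
have xqE : x * q = (-1) ^+ e / P 1 by have := cE 0%N; rewrite expr1.
rewrite (signed_prefactor (mn_pow_gt0 1) xqE).
have -> : x%:C = (-1) ^+ e / M by rewrite fmorph_div rmorph_sign fmorph_rat.
have -> : q%:C = 1 / N by rewrite fmorphV rmorph_nat div1r.
have -> : (P 1 - (-1) ^+ e)%:C = M * N - (-1) ^+ e.
  by rewrite rmorphB rmorph_sign fmorph_rat rmorphM rmorph_nat.
by rewrite mul1r -[(-1) ^+ e / M / N]mulrA -invfM.
Qed.

(** Here x q^(k+1) = (-1)^(e+k) / (m n^(k+1)).  For e = 1 the number x q is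
    negative, and only m n^2, not m n, has to exceed 2. *)
Lemma F_quotient_neg_base (e : bool) (a : nat -> rat) :
  2 * (-1) ^+ e < m * n%:R -> 2 < m * n%:R ^+ 2 ->
  (forall k, a k = m * n%:R ^+ k.+1 - 2 * (-1) ^+ (e + k)) ->
  let M : R[i] := ratr m in let N : R[i] := n%:R in
  regular_cf_value a ((M * N - (-1) ^+ e) *
    (F (- (-1) ^+ e / M) 1 (-1 / N) / F ((-1) ^+ e / (M * N)) 1 (-1 / N))).
Proof.
move=> mn_gt mn2_gt aE M N.
pose x : R := - (-1) ^+ e / ratr m; pose q : R := - n%:R^-1.
have n0 : (0 : R) < n%:R by rewrite ltr0n ltnW.
have m0 : (0 : R) < ratr m by rewrite ltr0q.
have cE k : x * q ^+ k.+1 = (-1) ^+ (e + k) / P k.+1.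
  rewrite /x /q (exprNn n%:R^-1) exprVn rmorphM rmorphXn /= ratr_nat.
  by rewrite [(ratr m * _)^-1]invfM exprD exprS; ring.
have sign_le k : 2 * (-1) ^+ (e + k.+1) < m * n%:R ^+ k.+2.
  have := mn_pow_le (isT : (2 <= k.+2)%N).
  by rewrite -signr_odd; case: (odd _); rewrite ?expr1 ?expr0; lra.
have tq : tame x q.
  apply: tame_of_norms; first by rewrite /q normrN gtr0_norm // invr_gt0.
    have := cE 0%N; rewrite expr1 addn0 => ->.
    by rewrite normrMsign gtr0_norm // invr_gt0 mn_pow_gt0.
  move=> i; rewrite cE half_ge_signed ?mn_pow_gt0 // -ratr_double_sign ler_rat.
  by case: i => [|i]; [rewrite addn0 expr1 | ]; apply: ltW.
have x0 : x != 0 by rewrite mulf_neq0 ?oppr_eq0 ?signr_eq0 // invr_eq0 gt_eqF.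
have q_lt0 : q < 0 by rewrite oppr_lt0 invr_gt0.
have cfa : regular_cf_value a
    ((1 - x * q) / `|x * q| * (F x 1 q / F (x * q) 1 q)).
  apply: (@regular_cf_value_neg_base R x q tq x0 (ltr0_neq0 q_lt0) a) => //.
  - by move=> k; rewrite aE rpredB ?mn_pow_int ?double_sign_int.
  - by move=> k; rewrite aE subr_gt0.
  - move=> k; rewrite (signed_partial_quotient _ (cE k)) ?mn_pow_gt0 //.
    by rewrite aE rmorphB /= ratr_double_sign.
have := regular_cf_value_real_complex tq cfa.
have xqE : x * q = (-1) ^+ e / P 1 by have := cE 0%N; rewrite expr1 addn0.
rewrite (signed_prefactor (mn_pow_gt0 1) xqE) -rmorphM xqE.
have -> : x%:C = - (-1) ^+ e / M.
  by rewrite fmorph_div rmorphN rmorph_sign fmorph_rat.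
have -> : q%:C = -1 / N by rewrite rmorphN fmorphV rmorph_nat mulN1r.
have PE : (P 1)%:C = M * N by rewrite fmorph_rat rmorphM rmorph_nat.
have -> : (P 1 - (-1) ^+ e)%:C = M * N - (-1) ^+ e.
  by rewrite rmorphB /= PE rmorph_sign.
by rewrite fmorph_div rmorph_sign /= PE.
Qed.

End Bases.

Theorem theorem7 (R : realType) (n : nat) (m : rat)
    (hn : (1 < n)%N) (hm : 0 < m) (hmn : m * n%:R \is a Num.int) :
  let M : R[i] := ratr m in
  let N : R[i] := n%:R in
  [/\ 4 < m * n%:R ->
        regular_cf_value
          (cf_blocks (m * n%:R - 3)
             [:: fun=> 1; fun k => m * n%:R ^+ k - 4] 2)
          ((M * N - 1) * (F (1 / M) 1 (1 / N) / F (1 / (M * N)) 1 (1 / N))),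
      2 < m * n%:R ->
        regular_cf_value
          (cf_blocks (m * n%:R - 2)
             [:: fun k => m * n%:R ^+ (2 * k) + 2;
                 fun k => m * n%:R ^+ (2 * k + 1) - 2] 1)
          ((M * N - 1) *
             (F (- 1 / M) 1 (- 1 / N) / F (1 / (M * N)) 1 (- 1 / N)))
        /\
        regular_cf_value
          (cf_blocks (m * n%:R + 1)
             [:: fun=> 1; fun k => m * n%:R ^+ k] 2)
          ((M * N + 1) *
             (F (- 1 / M) 1 (1 / N) / F (- 1 / (M * N)) 1 (1 / N))) &
      2 < m * n%:R ^+ 2 ->
        regular_cf_value
          (cf_blocks (m * n%:R + 2)
             [:: fun k => m * n%:R ^+ (2 * k) - 2;
                 fun k => m * n%:R ^+ (2 * k + 1) + 2] 1)
          ((M * N + 1) *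
             (F (1 / M) 1 (- 1 / N) / F (- 1 / (M * N)) 1 (- 1 / N)))].
Proof.
move=> M N; have mn2 : m * n%:R <= m * n%:R ^+ 2.
  by have := mn_pow_le hn hm (isT : (1 <= 2)%N); rewrite expr1.
have odd_block i : m * n%:R ^+ (2 * (1 + i)) = m * n%:R ^+ i.*2.+2.
  by rewrite mul2n doubleD.
have even_block i : m * n%:R ^+ (2 * (1 + i) + 1) = m * n%:R ^+ i.*2.+3.
  by rewrite mul2n doubleD addn1.
have alternate (a : nat -> rat) (e : bool) :
    a 0%N = m * n%:R - 2 * (-1) ^+ e ->
    (forall i, a i.*2.+1 = m * n%:R ^+ i.*2.+2 + 2 * (-1) ^+ e) ->
    (forall i, a i.*2.+2 = m * n%:R ^+ i.*2.+3 - 2 * (-1) ^+ e) ->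
    forall k, a k = m * n%:R ^+ k.+1 - 2 * (-1) ^+ (e + k).
  have sign_odd i : (-1) ^+ (e + i.*2.+1) = - (-1) ^+ e :> rat.
    by rewrite -signr_odd oddD oddb /= odd_double addbT signrN.
  have sign_even i : (-1) ^+ (e + i.*2.+2) = (-1) ^+ e :> rat.
    by rewrite -signr_odd oddD oddb /= odd_double addbF.
  move=> a0 a1 a2; apply: nat_parity_ind => [|i|i].
  - by rewrite a0 addn0 expr1.
  - by rewrite a1 sign_odd mulrN opprK.
  - by rewrite a2 sign_even.
split=> [mn_gt | mn_gt | mn2_gt]; [|split|].
- have := @F_quotient_pos_base R n m hn hm hmn false.
  rewrite expr0; apply=> [||i|i];
    rewrite ?cf_blocks_odd ?cf_blocks_even //=; lra.
- have := @F_quotient_neg_base R n m hn hm hmn false.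
  rewrite expr0; apply; [lra|lra|].
  by apply: alternate => [|i|i]; rewrite ?cf_blocks_odd ?cf_blocks_even //=
    ?odd_block ?even_block; lra.
- have := @F_quotient_pos_base R n m hn hm hmn true.
  rewrite expr1 opprK; apply=> [||i|i];
    rewrite ?cf_blocks_odd ?cf_blocks_even //=; lra.
- have := @F_quotient_neg_base R n m hn hm hmn true.
  rewrite expr1 opprK; apply; [|by []|].
    by have : 0 < m * n%:R; [rewrite mulr_gt0 // ltr0n ltnW | lra].
  by apply: alternate => [|i|i]; rewrite ?cf_blocks_odd ?cf_blocks_even //=
    ?odd_block ?even_block; lra.
Qed.
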